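(* Let $\mathfrak{V}$ be a linear subspace of $\mathcal{L}(\mathbf{R}^n,\mathbf{R}^m)$. Then $\delta(\mathfrak{V})<\infty$ if and only if $\mathfrak{V}$ contains neither a rank one operator, nor a vector subspace of the form $P\mathfrak{W}Q$ with $P\in GL(m)$, $Q\in GL(n)$, where (identifying operators with $m\times n$ real matrices) $$\mathfrak{W}=\operatorname{span}\left\{\begin{pmatrix}I_2&0\\0&0\end{pmatrix},\begin{pmatrix}J_2&0\\0&0\end{pmatrix}\right\},\qquad I_2=\begin{pmatrix}1&0\\0&1\end{pmatrix},\quad J_2=\begin{pmatrix}0&-1\\1&0\end{pmatrix}.$$
   Context: $n,m\ge 1$ are integers and $\mathcal{L}(\mathbf{R}^n,\mathbf{R}^m)$ is the space of linear operators $\mathbf{R}^n\to\mathbf{R}^m$. The space $\mathfrak{W}$ is a space of $m\times n$ matrices and makes sense only for $n,m\ge 2$; if $n=1$ or $m=1$ the condition concerning $\mathfrak{W}$ is void. $\operatorname{Sym}^k(\mathbf{R}^n;\mathbf{R}^m)$ is the space of symmetric $k$-linear maps $(\mathbf{R}^n)^k\to\mathbf{R}^m$. For $k\ge 1$, $$M_k(\mathfrak{V})=\{T\in\operatorname{Sym}^k(\mathbf{R}^n;\mathbf{R}^m)\mid \forall x_1,\dots,x_{k-1}\in\mathbf{R}^n\text{ the operator }x\mapsto T(x_1,\dots,x_{k-1},x)\text{ belongs to }\mathfrak{V}\},$$ $M_0(\mathfrak{V})=\mathbf{R}^m$, and $\delta(\mathfrak{V})=\sup\{k\mid M_k(\mathfrak{V})\neq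 0\}\in\mathbf{N}\cup\{\infty\}$. *)

(* Defs.v *)
From mathcomp Require Import all_boot all_order all_algebra all_fingroup.
From mathcomp Require Import boolp classical_sets functions reals constructive_ereal ereal.

Set Implicit Arguments.
Unset Strict Implicit.
Unset Printing Implicit Defensive.

Import Order.TTheory GRing.Theory Num.Theory.

Local Open Scope classical_set_scope.
Local Open Scope ring_scope.

(* R^n is 'cV[R]_n and L(R^n, R^m) is 'Hom('cV[R]_n, 'cV[R]_m);
   an m x n matrix is identified with the operator x |-> A *m x. *)

Section SymmetricMaps.
Variables (R : realType) (n m : nat).

Definition subst_tuple k (x : k.-tuple 'cV[R]_n) (i : 'I_k) (v : 'cV[R]_n) :
    k.-tuple 'cV[R]_n :=
  [tuple if j == i then v else tnth x j | j < k].

Definition multilinear k (T : k.-tuple 'cV[R]_n -> 'cV[R]_m) : Prop :=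
  forall (x : k.-tuple 'cV[R]_n) (i : 'I_k), linear (fun v => T (subst_tuple x i v)).

Definition symmetric_map k (T : k.-tuple 'cV[R]_n -> 'cV[R]_m) : Prop :=
  forall (s : 'S_k) (x : k.-tuple 'cV[R]_n),
    T [tuple tnth x (s i) | i < k] = T x.

Definition Sym k : set (k.-tuple 'cV[R]_n -> 'cV[R]_m) :=
  [set T | multilinear T /\ symmetric_map T].

(* M_0 is R^m, seen as the maps on the one-element type 0.-tuple 'cV[R]_n. *)
Definition M (V : {vspace 'Hom('cV[R]_n, 'cV[R]_m)}) k :
    set (k.-tuple 'cV[R]_n -> 'cV[R]_m) :=
  match k with
  | 0 => setT
  | k'.+1 => [set T | Sym T /\
      forall x : k'.-tuple 'cV[R]_n,
        exists2 f : 'Hom('cV[R]_n, 'cV[R]_m),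
          f \in V & forall v, f v = T [tuple of rcons x v]]
  end.
Arguments M : clear implicits.

Definition delta (V : {vspace 'Hom('cV[R]_n, 'cV[R]_m)}) : \bar R :=
  ereal_sup [set k%:R%:E | k in [set k | M V k <> [set cst 0]]].

Definition rank_one (f : 'Hom('cV[R]_n, 'cV[R]_m)) : Prop := \dim (limg f) = 1%N.

Definition mxop (A : 'M[R]_(m, n)) : 'Hom('cV[R]_n, 'cV[R]_m) :=
  linfun (mulmx A).

(* The m x n matrix with upper left block B and zeros elsewhere; this is the
   intended object only when 2 <= m and 2 <= n (otherwise B is truncated). *)
Definition corner_mx (B : 'M[R]_2) : 'M[R]_(m, n) :=
  \matrix_(i, j) if (i < 2)%N && (j < 2)%N then B (inord i) (inord j) else 0.

Definition J2 : 'M[R]_2 := block_mx (0 : 'M_1) (- 1%:M) 1%:M (0 : 'M_1).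

Definition frakW : {vspace 'M[R]_(m, n)} :=
  <<[:: corner_mx 1%:M; corner_mx J2]>>%VS.

(* V contains some P W Q; never the case when n < 2 or m < 2, where W makes
   no sense. *)
Definition contains_PWQ (V : {vspace 'Hom('cV[R]_n, 'cV[R]_m)}) : Prop :=
  [/\ (2 <= n)%N, (2 <= m)%N &
    exists (P : 'M[R]_m) (Q : 'M[R]_n),
      [/\ P \in unitmx, Q \in unitmx &
        forall A, A \in frakW -> mxop (P *m A *m Q) \in V]].

End SymmetricMaps.

(* Main.v *)
Require Import Defs.
From HB Require Import structures.
From mathcomp Require Import all_boot all_order all_algebra all_fingroup.
From mathcomp Require Import boolp classical_sets functions.
From mathcomp Require Import reals constructive_ereal ereal.
From mathcomp Require Import complex zify ring.
Set Implicit Arguments.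
Unset Strict Implicit.
Unset Printing Implicit Defensive.
Import Order.TTheory GRing.Theory Num.Theory.
Local Open Scope ring_scope.

(** Write C for R[i] and let V_C be the space of complex m x n matrices whose real
and imaginary parts lie in V.  Both sides of the equivalence are governed by
the characteristics of V: pairs of a nonzero complex column x and a nonzero
complex row u with x u in V_C.

Separating real and imaginary parts translates characteristics into the two
excluded configurations.  If u or x is a complex multiple of a real vector,
then the real or the imaginary part of x u, up to a complex factor, is a real
operator of rank one.  Otherwise the real and imaginary parts of x are
independent, and so are those of u; completed to bases they give P and Q with
Re (x u) and Im (x u) equal to the two generators of P W Q up to sign
([characteristic_rank_one_or_PWQ]).  Both configurations conversely contain a
characteristic ([rank_one_characteristic], [contains_PWQ_characteristic]).

A characteristic makes every M_k nonzero: the maps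
v_1, ..., v_k |-> Re (z u(v_1) ... u(v_k) x) belong to M_k for every complex z
([characteristic_M_neq0]).

The substance is the converse: if M_k is nonzero for every k, then V has a
characteristic ([infinite_type_rank_one]).  This is the statement that a graded
module over a polynomial ring, infinite dimensional and generated in degree
zero, has a nonzero point in its support.  The proof below replaces the
Nullstellensatz by finite-dimensional linear algebra.  For a subspace U of C^n
let S_k(U) be the space of complex symmetric tensors of degree k, with slices
in V_C, that are killed by contraction with U.  Suppose S_k(U) is nonzero for
all k, and take v outside U.  If S_k(U + v) is nonzero for all k, enlarge U by
v.  Otherwise contraction with v is injective on S_k(U) for k large, so the
dimensions of the S_k(U) are eventually nonincreasing, hence constant, and
contraction with v is eventually an isomorphism.  For a further vector v' the pencil of
contractions with v' - c v then has an eigenvector for some c, which lies in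
S_k(U + (v' - c v)); transporting it along the isomorphisms shows that these
spaces are nonzero for all k, so U can be enlarged again
([infinite_type_extend]).  The process stops only when a nonzero element of
S_1(U), a matrix of V_C vanishing on U, has rank one. *)

(** * Subspaces and pencils of linear maps *)

(** Subspaces are handled as predicates, since the conditions that define them
below are propositions rather than boolean tests. *)
Definition linear_pred (F : fieldType) (E : lmodType F) (P : E -> Prop) : Prop :=
  P 0 /\ forall (a : F) x y, P x -> P y -> P (a *: x + y).

Section LinearPred.
Variables (F : fieldType) (E : lmodType F) (P : E -> Prop).
Hypothesis linP : linear_pred P.

Lemma linear_predZ a x : P x -> P (a *: x).
Proof. by case: linP => P0 PD Px; rewrite -[_ *: _]addr0; apply: PD. Qed.

Lemma linear_predD x y : P x -> P y -> P (x + y).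
Proof. by case: linP => P0 PD Px Py; rewrite -[x]scale1r; apply: PD. Qed.

Lemma linear_pred_sum (I : finType) (G : I -> E) :
  (forall i, P (G i)) -> P (\sum_i G i).
Proof.
by move=> PG; elim/big_ind: _ => // [|x y]; [case: linP | apply: linear_predD].
Qed.
End LinearPred.

(** A subspace of maximal dimension among those contained in [P] exhausts [P]:
otherwise a missing vector would enlarge it. *)
Lemma vspace_of_linear_pred (F : fieldType) (E : vectType F) (P : E -> Prop) :
  linear_pred P -> exists K : {vspace E}, forall x, x \in K <-> P x.
Proof.
move=> linP.
pose dimP d := `[< exists2 K : {vspace E}, \dim K = d & forall x, x \in K -> P x >].
have dim0 : exists d, dimP d.
  exists 0%N; apply/asboolP; exists 0%VS; first by rewrite dimv0.
  by move=> x; rewrite memv0 => /eqP->; case: linP.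
have bound d : dimP d -> (d <= \dim {:E})%N.
  by move=> /asboolP[K <- _]; rewrite dimvS ?subvf.
case: (ex_maxnP dim0 bound) => d /asboolP[K dK KP] maxd.
exists K => x; split; first exact: KP.
move=> Px; apply: contraT => xK.
suff : dimP d.+1 by move=> /maxd; rewrite ltnn.
apply/asboolP; exists (K + <[x]>)%VS; last first.
  move=> _ /memv_addP[y yK [_ /vlineP[a ->] ->]].
  by apply: linear_predD => //; [apply: KP | apply: linear_predZ].
have x0 : x != 0 by apply: contraNneq xK => ->; rewrite mem0v.
rewrite dimv_disjoint_sum ?dK ?dim_vline ?x0 ?addn1 //.
apply/eqP; rewrite -subv0; apply/subvP => y /memv_capP[yK /vlineP[a ya]].
rewrite memv0 ya scaler_eq0 (negbTE x0) orbF; apply: contraNT xK => a0.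
by rewrite -[x](scalerK a0) -ya memvZ.
Qed.

Lemma rank1_factor (F : fieldType) m n (A : 'M[F]_(m, n)) : \rank A = 1%N ->
  exists (x : 'cV_m) (u : 'rV_n), [/\ x != 0, u != 0 & A = x *m u].
Proof.
move=> rA; have A0 : A != 0 by rewrite -mxrank_eq0 rA.
move: (col_base A) (row_base A) (mulmx_base A); rewrite rA => x u xuA.
exists x, u; split=> //; apply: contraNneq A0 => z0.
  by rewrite -xuA z0 mul0mx.
by rewrite -xuA z0 mulmx0.
Qed.

Lemma eventually_constant (d : nat -> nat) k1 :
  (forall k, (k1 <= k)%N -> (d k.+1 <= d k)%N) ->
  exists2 k2, (k1 <= k2)%N & forall k, (k2 <= k)%N -> d k = d k2.
Proof.
move=> decr.
have decr_le k2 k : (k1 <= k2)%N -> (k2 <= k)%N -> (d k <= d k2)%N.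
  move=> le12; elim: k => [|k IH]; first by rewrite leqn0 => /eqP->.
  rewrite leq_eqVlt => /predU1P[-> //|lek].
  by apply: leq_trans (IH lek); apply: decr; exact: leq_trans le12 lek.
have exv : exists v, `[< exists2 k, (k1 <= k)%N & d k = v >].
  by exists (d k1); apply/asboolP; exists k1.
case: (ex_minnP exv) => v /asboolP[k2 le12 <-] minv.
exists k2 => // k le2; apply/eqP; rewrite eqn_leq decr_le //.
by apply: minv; apply/asboolP; exists k; first exact: leq_trans le2.
Qed.

(** Expressing [g] in terms of [f] on a basis of [K] gives a square matrix of
positive size.  A row eigenvector of that matrix is the coordinate vector of
[x]. *)
Lemma pencil_eigenvector (C : closedFieldType) (E1 E2 : vectType C)
    (f g : 'Hom(E1, E2)) (K : {vspace E1}) :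
  K != 0%VS -> (g @: K <= f @: K)%VS ->
  exists c x, [/\ x \in K, x != 0 & g x = c *: f x].
Proof.
move=> K0 gf.
have hpre (i : 'I_(\dim K)) :
    exists y, (y \in K) && (g (vbasis K)`_i == f y).
  have : g (vbasis K)`_i \in (f @: K)%VS.
    apply: (subvP gf); apply: memv_img; apply: vbasis_mem.
    by rewrite mem_nth ?size_tuple.
  by move=> /memv_imgP[y yK ->]; exists y; rewrite yK eqxx.
pose y i := xchoose (hpre i).
have yP i : y i \in K /\ g (vbasis K)`_i = f (y i).
  by have /andP[? /eqP] := xchooseP (hpre i).
pose A := \matrix_(i < \dim K, j < \dim K) coord (vbasis K) j (y i).
have dK : (0 < \dim K)%N by rewrite lt0n dimv_eq0.
have /closed_rootP[c] : size (char_poly A) != 1%N.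
  by rewrite size_char_poly eqSS -lt0n.
rewrite -eigenvalue_root_char => /eigenvalueP[a aA a0].
exists c, (\sum_i a 0 i *: (vbasis K)`_i); split.
- by apply: memv_suml => i _; rewrite memvZ // vbasis_mem // mem_nth ?size_tuple.
- apply: contraNneq a0 => s0; apply/eqP/rowP => i; rewrite mxE.
  by have /freeP := basis_free (vbasisP K); apply.
- transitivity (f (\sum_i a 0 i *: y i)).
    rewrite !linear_sum; apply: eq_bigr => i _.
    by rewrite !linearZ /=; case: (yP i) => _ ->.
  rewrite -linearZ; congr (f _).
  under eq_bigr => i _ do
    rewrite (coord_vbasis (proj1 (yP i))) scaler_sumr.
  rewrite exchange_big scaler_sumr; apply: eq_bigr => j _ /=.
  have := congr1 (fun u : 'rV_(_) => u 0 j) aA.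
  rewrite !mxE scalerA => <-; rewrite scaler_suml; apply: eq_bigr => i _.
  by rewrite scalerA mxE.
Qed.

(** * Complex symmetric tensors with slices in a space of matrices *)

Lemma perm_swap (I : eqType) (i j : I) (s : seq I) :
  perm_eq (i :: j :: s) (j :: i :: s).
Proof. by apply/permPl; apply: (perm_catCA [:: i] [:: j]). Qed.

Section Prolongation.
Variables (C : closedFieldType) (n m : nat) (W : 'M[C]_(m, n) -> Prop).
Hypothesis linW : linear_pred W.

(** A tensor of degree [k] is given by its values on the tuples of basis vectors
of C^n, which makes the tensors a finite-dimensional space. *)
Definition tensor k := {ffun k.-tuple 'I_n -> 'cV[C]_m}.

Definition contr k (v : 'rV[C]_n) (T : tensor k.+1) : tensor k :=
  [ffun t : k.-tuple 'I_n => \sum_i v 0 i *: T [tuple of i :: t]].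

Definition slice k (T : tensor k.+1) (t : k.-tuple 'I_n) : 'M[C]_(m, n) :=
  \matrix_(l, j) T [tuple of j :: t] l 0.

(** The space S_k.+1(U) of the introductory comment.  Degree zero is left out:
there is nothing to contract, and nonzero tensors of positive degree have
nonzero contractions. *)
Definition prolong (U : 'M[C]_n) k (T : tensor k.+1) : Prop :=
  [/\ forall t t' : k.+1.-tuple 'I_n, perm_eq t t' -> T t = T t',
      forall t, W (slice T t)
    & forall u : 'rV_n, (u <= U)%MS -> contr u T = 0].

Lemma contr_is_linear k v : linear (@contr k v).
Proof.
move=> a S T; apply/ffunP => t; rewrite !ffunE scaler_sumr -big_split.
by apply: eq_bigr => i _; rewrite !ffunE scalerDr !scalerA mulrC.
Qed.

HB.instance Definition _ k v :=
  GRing.isLinear.Build C (tensor k.+1) (tensor k) _ (@contr k v)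
    (@contr_is_linear k v).

Lemma contrDl k a v w (T : tensor k.+1) :
  contr (a *: v + w) T = a *: contr v T + contr w T.
Proof.
apply/ffunP => t; rewrite !ffunE scaler_sumr -big_split.
by apply: eq_bigr => i _; rewrite !mxE scalerDl scalerA.
Qed.

Lemma contr_delta k i (T : tensor k.+1) t :
  contr (delta_mx 0 i) T t = T [tuple of i :: t].
Proof.
rewrite ffunE (bigD1 i) //= mxE !eqxx scale1r big1 ?addr0 // => j ji.
by rewrite mxE (negbTE ji) andbF scale0r.
Qed.

(** A tensor is determined by its contractions; so once the prolongations vanish
in one degree, they vanish in all higher degrees. *)
Lemma contr_eq0 k (T : tensor k.+1) : (forall v, contr v T = 0) -> T = 0.
Proof.
move=> T0; apply/ffunP => t; case/tupleP: t => i t.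
by rewrite -contr_delta T0 !ffunE.
Qed.

Lemma contrC k (T : tensor k.+2) v w :
  (forall t t' : k.+2.-tuple 'I_n, perm_eq t t' -> T t = T t') ->
  contr v (contr w T) = contr w (contr v T).
Proof.
move=> symT; apply/ffunP => t; rewrite !ffunE.
under eq_bigr do rewrite ffunE scaler_sumr.
under [RHS]eq_bigr do rewrite ffunE scaler_sumr.
rewrite exchange_big; apply: eq_bigr => i _; apply: eq_bigr => j _.
rewrite !scalerA mulrC; congr (_ *: _); apply: symT.
exact: perm_swap.
Qed.

Lemma prolong_linear U k : linear_pred (@prolong U k).
Proof.
split.
  split=> [t t' _|t|u _]; [by rewrite !ffunE| |by rewrite linear0].
  suff -> : slice (0 : tensor k.+1) t = 0 by case: linW.
  by apply/matrixP => l j; rewrite !mxE ffunE mxE.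
move=> a S T [symS WS US] [symT WT UT]; split=> [t t' tt'|t|u uU].
- by rewrite !ffunE (symS _ _ tt') (symT _ _ tt').
- suff -> : slice (a *: S + T) t = a *: slice S t + slice T t.
    by case: linW => _; apply.
  by apply/matrixP => l j; rewrite !mxE !ffunE !mxE.
- by rewrite linearP /= US // UT // scaler0 addr0.
Qed.

Lemma prolong_contr U k (T : tensor k.+2) v :
  prolong U T -> prolong U (contr v T).
Proof.
move=> [symT WT UT]; split=> [t t' tt'|t|u uU].
- rewrite !ffunE; apply: eq_bigr => i _; congr (_ *: _).
  by apply: symT; rewrite /= perm_cons.
- suff -> : slice (contr v T) t = \sum_i v 0 i *: slice T [tuple of i :: t].
    by apply: linear_pred_sum => // i; apply: linear_predZ.
  apply/matrixP => l j; rewrite !mxE ffunE !summxE; apply: eq_bigr => i _.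
  rewrite !mxE; congr (_ * _); congr (fun_of_matrix _ _ _); apply: symT.
  exact: perm_swap.
- by rewrite contrC // UT // linear0.
Qed.

Lemma prolongS U k (T : tensor k.+1) v :
  prolong U T -> contr v T = 0 -> prolong (U + v)%MS T.
Proof.
move=> [symT WT UT] vT; split=> // u /sub_addsmxP[[a b] /= ->].
have -> : b *m v = b 0 0 *: v by rewrite [b]mx11_scalar mul_scalar_mx mxE mulr1n.
by rewrite addrC contrDl vT scaler0 add0r UT // submxMl.
Qed.

Definition infinite_type U := forall k, exists2 T : tensor k.+1, prolong U T & T != 0.

Lemma finite_type_vanish U : ~ infinite_type U ->
  exists k0, forall k, (k0 <= k)%N -> forall T : tensor k.+1, prolong U T -> T = 0.
Proof.
move=> /existsNP[k0 dead]; exists k0.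
elim=> [|k IH].
  rewrite leqn0 => /eqP k00 T UT; apply: contrapT => T0; apply: dead.
  by rewrite k00; exists T => //; apply/eqP.
rewrite leq_eqVlt => /predU1P[k0E|lek] T UT.
  by apply: contrapT => T0; apply: dead; rewrite k0E; exists T => //; apply/eqP.
by apply: contr_eq0 => v; apply: IH => //; apply: prolong_contr.
Qed.

(** The step that enlarges [U]: the prolongations killed by [v] die out, so
contraction with [v] is eventually an isomorphism between consecutive degrees,
and it carries an eigenvector of the pencil spanned by [v] and [v'] to all
higher degrees. *)
Lemma infinite_type_extend (U : 'M[C]_n) (v v' : 'rV[C]_n) :
  infinite_type U -> ~ infinite_type (U + v)%MS ->
  exists c, infinite_type (U + (v' - c *: v))%MS.
Proof.
move=> liveU /finite_type_vanish[k0 dead].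
pose K k := projT1 (cid (vspace_of_linear_pred (@prolong_linear U k))).
have KP k T : T \in K k <-> prolong U T.
  exact: (projT2 (cid (vspace_of_linear_pred (@prolong_linear U k)))).
pose f k w : 'Hom(tensor k.+1, tensor k) := linfun (contr w).
have fE k w T : f k w T = contr w T by rewrite lfunE.
have inj k (T : tensor k.+1) : (k0 <= k)%N -> prolong U T -> contr v T = 0 -> T = 0.
  by move=> lek UT vT; apply: (dead k lek); apply: prolongS.
have fK k w : (f k.+1 w @: K k.+1 <= K k)%VS.
  apply/subvP => _ /memv_imgP[T /KP UT ->]; apply/KP.
  by rewrite fE; apply: prolong_contr.
have dimf k : (k0 <= k)%N -> \dim (f k.+1 v @: K k.+1) = \dim (K k.+1).
  move=> lek; apply: limg_dim_eq; apply/eqP; rewrite -subv0; apply/subvP => T.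
  move=> /memv_capP[/KP UT]; rewrite memv_ker fE => /eqP vT.
  by rewrite memv0; apply/eqP; apply: inj UT vT; apply: leqW.
have [k lek dimK] : exists2 k, (k0 <= k)%N &
    forall j, (k <= j)%N -> \dim (K j) = \dim (K k).
  apply: (@eventually_constant (fun k => \dim (K k))) => k lek.
  by rewrite -dimf // dimvS.
have surj j : (k <= j)%N -> (f j.+1 v @: K j.+1)%VS = K j.
  move=> lekj; apply/eqP; rewrite eqEdim fK dimf ?(leq_trans lek lekj) //=.
  by rewrite (dimK _ lekj) (dimK _ (leqW lekj)).
have K0 j : K j != 0%VS.
  have [T UT T0] := liveU j; apply: contraNneq T0 => Kj0.
  by rewrite -memv0 -Kj0; apply/KP.
have [|c [T [/KP UT T0]]] :=
  @pencil_eigenvector _ _ _ (f k.+1 v) (f k.+1 v') _ (K0 k.+1).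
  by rewrite surj.
rewrite !fE => eigT; exists c.
have contr_pencil j (S : tensor j.+1) :
    contr (v' - c *: v) S = contr v' S - c *: contr v S.
  by rewrite addrC -scaleNr contrDl scaleNr addrC.
(* The same [c] works in every later degree: a preimage of an eigenvector under
   contraction with [v] is again one, as contractions commute and [inj] holds. *)
have late j : (k.+1 <= j)%N ->
    exists2 S : tensor j.+1, prolong (U + (v' - c *: v))%MS S & S != 0.
  move=> lej.
  suff [S [US S0 cS]] : exists S : tensor j.+1,
      [/\ prolong U S, S != 0 & contr (v' - c *: v) S = 0].
    by exists S => //; apply: prolongS.
  elim: j lej => // j IH; rewrite leq_eqVlt => /predU1P[[<-]|lej].
    by exists T; split=> //; rewrite contr_pencil eigT subrr.
  have [S [/KP US S0 cS]] := IH lej.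
  move: US; rewrite -surj; last exact: ltnW.
  move=> /memv_imgP[S' /KP US' SE]; rewrite fE in SE.
  exists S'; split=> //; first by apply: contraNneq S0 => S'0; rewrite SE S'0 linear0.
  have [symS' _ _] := US'.
  apply: (@inj j); first by rewrite (leq_trans lek) // ltnW // ltnW.
    exact: prolong_contr.
  by rewrite contrC // -SE.
apply: contrapT => /finite_type_vanish[k1 dead1].
have [S US /eqP] := late (maxn k.+1 k1) (leq_maxl _ _).
by apply; apply: dead1 US; apply: leq_maxr.
Qed.

(** Induction on the codimension of [U].  A nonzero prolongation of degree one is
a matrix [A] of [W] with U A^T = 0; if its rank is at least two, then [U] has
codimension at least two, which leaves room for the vectors [v] and [v'] of
[infinite_type_extend]. *)
Lemma infinite_type_rank_one (U : 'M[C]_n) :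
  infinite_type U -> exists2 A, W A & \rank A = 1%N.
Proof.
have [r] := ubnP (n - \rank U)%N.
elim: r U => // r IH U ltr liveU.
have lt_add (U' : 'M[C]_n) (v : 'rV_n) :
    ~~ (v <= U')%MS -> (\rank U' < \rank (U' + v)%MS)%N.
  move=> vU; rewrite ltnNge; apply: contra vU => le.
  apply: submx_trans (addsmxSr U' v) _.
  by rewrite -(geq_leqif (mxrank_leqif_sup (addsmxSl U' v))).
have extend (v : 'rV_n) : ~~ (v <= U)%MS -> infinite_type (U + v)%MS ->
    exists2 A, W A & \rank A = 1%N.
  move=> /lt_add vU; apply: IH; have := rank_leq_row (U + v)%MS.
  by move: ltr vU; lia.
have outside (U' : 'M[C]_n) : (\rank U' < n)%N -> exists v : 'rV_n, ~~ (v <= U')%MS.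
  move=> rU'; have : ~~ (1%:M <= U')%MS.
    by rewrite sub1mx /row_full neq_ltn rU'.
  by move=> /row_subPn[i iU]; exists (row i 1%:M).
have [T [symT WT UT] T0] := liveU 0%N.
pose A := slice T [tuple].
have A0 : A != 0.
  apply: contraNneq T0 => A0; apply/eqP/ffunP => t; apply/colP => l.
  have [i ->] : exists i, t = [tuple of i :: [tuple]].
    by case/tupleP: t => i t; exists i; rewrite (tuple0 t).
  by have := congr1 (fun B : 'M_(m, n) => B l i) A0; rewrite ffunE !mxE.
have UA : U *m A^T = 0.
  apply/row_matrixP => i; rewrite row_mul row0; apply/rowP => l.
  have /ffunP/(_ [tuple]) := UT _ (row_sub i U).
  rewrite !ffunE => /colP/(_ l); rewrite !mxE summxE => {2}<-.
  by apply: eq_bigr => j _; rewrite !mxE.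
have rUA : (\rank U + \rank A <= n)%N.
  by rewrite -[\rank A]mxrank_tr; apply: mulmx0_rank_max.
have [rA|rA] := eqVneq (\rank A) 1%N; first by exists A => //; apply: WT.
have rA2 : (1 < \rank A)%N by rewrite ltn_neqAle eq_sym rA lt0n mxrank_eq0.
have [v vU] : exists v : 'rV_n, ~~ (v <= U)%MS by apply: outside; lia.
have [/extend|deadv] := pselect (infinite_type (U + v)%MS); first exact.
have [v' v'U] : exists v' : 'rV_n, ~~ (v' <= U + v)%MS.
  apply: outside; have := (mxrank_adds_leqif U v).1; have := rank_leq_row v.
  by move: rUA rA2; lia.
have [c] := infinite_type_extend v' liveU deadv; apply: extend.
apply: contra v'U => v'cU; rewrite -[v'](subrK (c *: v)) addmx_sub //.
  exact: submx_trans (addsmxSl _ _).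
by rewrite scalemx_sub // addsmxSr.
Qed.
End Prolongation.

(** * Complexification of a space of real operators *)

Section Complexification.
Variable R : realType.
Local Notation C := R[i].
Local Notation ReM := (map_mx (@complex.Re R)).
Local Notation ImM := (map_mx (@complex.Im R)).

Definition cmx p q (A B : 'M[R]_(p, q)) : 'M[C]_(p, q) :=
  \matrix_(i, j) (A i j +i* B i j)%C.

Lemma ReM_cmx p q (A B : 'M[R]_(p, q)) : ReM (cmx A B) = A.
Proof. by apply/matrixP => i j; rewrite !mxE. Qed.

Lemma ImM_cmx p q (A B : 'M[R]_(p, q)) : ImM (cmx A B) = B.
Proof. by apply/matrixP => i j; rewrite !mxE. Qed.

Lemma cmxE p q (A : 'M[C]_(p, q)) : cmx (ReM A) (ImM A) = A.
Proof. by apply/matrixP => i j; rewrite !mxE; case: (A i j). Qed.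

Lemma cmx_mul p q r (A B : 'M[R]_(p, q)) (D E : 'M[R]_(q, r)) :
  cmx A B *m cmx D E = cmx (A *m D - B *m E) (A *m E + B *m D).
Proof.
apply/matrixP => i j; rewrite !mxE -sumrN -!big_split /=.
by elim/big_rec3: _ => // k x y z _ ->; rewrite !mxE.
Qed.

Lemma cmx_lin p q (c : C) (A B D E : 'M[R]_(p, q)) :
  c *: cmx A B + cmx D E =
  cmx (complex.Re c *: A - complex.Im c *: B + D)
      (complex.Re c *: B + complex.Im c *: A + E).
Proof. by case: c => a b; apply/matrixP => i j; rewrite !mxE. Qed.

Lemma cmx00 p q : cmx 0 0 = 0 :> 'M[C]_(p, q).
Proof. by apply/matrixP => i j; rewrite !mxE. Qed.

Lemma cmx_neq0 p q (A B : 'M[R]_(p, q)) : A != 0 -> cmx A B != 0.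
Proof.
by apply: contraNneq => AB0; rewrite -[A](ReM_cmx A B) AB0 -cmx00 ReM_cmx.
Qed.

(** The rank of the matrix with rows Re u and Im u is one or two; when it is one,
both rows are real multiples of a single real row. *)
Lemma real_direction n (u : 'rV[C]_n) : u != 0 ->
  row_free (col_mx (ReM u) (ImM u)) \/
  exists (z : C) (e : 'rV[R]_n), u = z *: cmx e 0.
Proof.
move=> u0; set B := col_mx _ _.
have B0 : (0 < \rank B)%N.
  rewrite lt0n mxrank_eq0; apply: contra u0 => /eqP B0.
  move: B0; rewrite -[0]vsubmxK => /eq_col_mx[Re0 Im0].
  by rewrite -[u]cmxE Re0 Im0 !linear0 cmx00.
have : (\rank B <= 2)%N by apply: rank_leq_row.
rewrite leq_eqVlt => /predU1P[rB|rB]; first by left; rewrite /row_free rB.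
have {B0 rB} rB : \rank B = 1%N by move: B0 rB; lia.
right; move: (col_base B) (row_base B) (mulmx_base B); rewrite rB => a e aeB.
exists (a 0 0 +i* a (rshift 1 0) 0)%C, e; rewrite -[u]cmxE.
have entry (i : 'I_(1 + 1)) j : B i j = a i 0 * e 0 j.
  by rewrite -aeB mxE big_ord_recl big_ord0 addr0.
apply/rowP => j; have := entry (lshift 1 0) j; have := entry (rshift 1 0) j.
rewrite col_mxEd col_mxEu !mxE => -> ->.
have -> : lshift 1 (0 : 'I_1) = 0 :> 'I_(1 + 1) by apply: val_inj.
by simpc.
Qed.

Section Operators.
Variables n m : nat.
Variable V : {vspace 'Hom('cV[R]_n, 'cV[R]_m)}.

Lemma mxopE (A : 'M[R]_(m, n)) v : mxop A v = A *m v.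
Proof. by rewrite lfunE. Qed.

Lemma mxop_lin a (A B : 'M[R]_(m, n)) : mxop (a *: A + B) = a *: mxop A + mxop B.
Proof.
apply/lfunP => v; rewrite add_lfunE scale_lfunE !mxopE.
by rewrite mulmxDl scalemxAl.
Qed.

Lemma mxop0 : mxop (0 : 'M[R]_(m, n)) = 0.
Proof. by apply/lfunP => v; rewrite mxopE mul0mx lfunE. Qed.

Lemma mxop_lin_mem a b (A B : 'M[R]_(m, n)) :
  mxop A \in V -> mxop B \in V -> mxop (a *: A + b *: B) \in V.
Proof.
move=> AV BV; rewrite -[b *: B]addr0.
by rewrite !mxop_lin mxop0 addr0 memvD // memvZ.
Qed.

Definition in_complexification (A : 'M[C]_(m, n)) : Prop :=
  mxop (ReM A) \in V /\ mxop (ImM A) \in V.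

Lemma in_complexification_linear : linear_pred in_complexification.
Proof.
rewrite /in_complexification; split.
  by rewrite -cmx00 ReM_cmx ImM_cmx mxop0 mem0v.
move=> c A B [ReA ImA] [ReB ImB].
rewrite -[A]cmxE -[B]cmxE cmx_lin ReM_cmx ImM_cmx -scaleNr.
have lin a b (D E F : 'M[R]_(m, n)) :
    mxop D \in V -> mxop E \in V -> mxop F \in V -> mxop (a *: D + b *: E + F) \in V.
  move=> DV EV FV; rewrite -[F]scale1r -[_ + b *: E]scale1r.
  by do 2 apply: mxop_lin_mem => //.
by split; apply: lin.
Qed.

Lemma rank_one_mxop (a : 'cV[R]_m) (b : 'rV[R]_n) :
  a != 0 -> b != 0 -> rank_one (mxop (a *m b)).
Proof.
move=> a0 b0; rewrite /rank_one.
suff -> : limg (mxop (a *m b)) = <[a]>%VS by rewrite dim_vline a0.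
have /rV0Pn[j bj] := b0.
have abE v : mxop (a *m b) v = (b *m v) 0 0 *: a.
  by rewrite mxopE -mulmxA {1}[b *m v]mx11_scalar mul_mx_scalar.
apply/eqP; rewrite eqEsubv; apply/andP; split; apply/subvP => x.
  by move=> /memv_imgP[v _ ->]; rewrite abE memvZ // memv_line.
move=> /vlineP[c ->]; apply/memv_imgP.
exists ((c / b 0 j) *: delta_mx j 0); first exact: memvf.
rewrite abE -scalemxAr mxE -colE mxE; congr (_ *: _).
by rewrite divfK.
Qed.

Lemma rank_one_outer_product (f : 'Hom('cV[R]_n, 'cV[R]_m)) : rank_one f ->
  exists (a : 'cV[R]_m) (b : 'rV[R]_n),
    [/\ a != 0, b != 0 & f = mxop (a *m b)].
Proof.
rewrite /rank_one => df; set a := vpick (limg f).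
have f0 : limg f != 0%VS by rewrite -dimv_eq0 df.
have a0 : a != 0 by rewrite vpick0.
have fa : limg f = <[a]>%VS.
  by apply/eqP; rewrite eq_sym eqEdim -memvE memv_pick df dim_vline a0.
have coef j : exists c, f (delta_mx j 0) = c *: a.
  by apply/vlineP; rewrite -fa memv_img ?memvf.
have [b bE] := choice coef.
have fE : f = mxop (a *m \row_j b j).
  apply/lfunP => v; rewrite mxopE -mulmxA [_ *m v]mx11_scalar mul_mx_scalar mxE.
  rewrite {1}[v]matrix_sum_delta linear_sum scaler_suml; apply: eq_bigr => j _.
  by rewrite big_ord_recl big_ord0 addr0 linearZ /= bE scalerA mxE mulrC.
exists a, (\row_j b j); split=> //; apply: contraNneq f0 => b0.
rewrite fE b0 mulmx0 -subv0; apply/subvP => x /memv_imgP[v _ ->].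
by rewrite mxopE mul0mx mem0v.
Qed.

End Operators.
End Complexification.

(** * Characteristics, rank one operators and the spaces P W Q *)

(** Two independent rows are the first two rows of an invertible matrix.  The
extended column base of [B] is a change of basis among the two rows only; a
block matrix moves it to the other side of [pid_mx 2]. *)
Lemma row_free_pid_mul (F : fieldType) n (B : 'M[F]_(2, n)) : row_free B ->
  (2 <= n)%N /\ exists2 Q, Q \in unitmx & pid_mx 2 *m Q = B.
Proof.
rewrite -row_leq_rank => rB2.
have n2 : (2 <= n)%N by apply: leq_trans (rank_leq_col B).
split=> //; have rB : \rank B = 2%N.
  by apply/eqP; rewrite eqn_leq rB2 rank_leq_row.
move: (mulmx_ebase B); rewrite rB.
move: (col_ebase_unit B) (row_ebase_unit B).
move: (col_ebase B) (row_ebase B) => L Q0 uL uQ <-.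
case: n n2 B rB2 rB Q0 uQ => [|[|n]] // _ _ _ _ Q0 uQ.
have uL1 : (block_mx L 0 0 1%:M : 'M_(2 + n)) \in unitmx.
  by rewrite unitmxE det_lblock det1 mulr1 -unitmxE.
exists ((block_mx L 0 0 1%:M : 'M_(2 + n)) *m Q0); first by rewrite unitmx_mul uL1.
have pidL : (pid_mx 2 : 'M_(2, 2 + n)) *m block_mx L 0 0 1%:M =
            L *m (pid_mx 2 : 'M_(2, 2 + n)).
  rewrite pid_mx_row mul_row_block mul_mx_row.
  by rewrite !mul1mx !mul0mx !mulmx0 mulmx1 !addr0.
by rewrite mulmxA [X in X *m _]pidL.
Qed.

Section Characteristics.
Variables (R : realType) (n m : nat).
Local Notation C := R[i].
Local Notation ReM := (map_mx (@complex.Re R)).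
Local Notation ImM := (map_mx (@complex.Im R)).
Variable V : {vspace 'Hom('cV[R]_n, 'cV[R]_m)}.

(** With [corner_mx] written through [pid_mx 2], P W Q depends only on the first
two columns of [P] and the first two rows of [Q]. *)
Lemma corner_mxE (B : 'M[R]_2) : corner_mx n m B = pid_mx 2 *m B *m pid_mx 2.
Proof.
have pidL p (i : 'I_p) (G : 'I_2 -> R) :
    \sum_k (pid_mx 2 : 'M[R]_(p, 2)) i k * G k = if (i < 2)%N then G (inord i) else 0.
  case: ifP => i2.
    rewrite (bigD1 (inord i)) //= mxE inordK // eqxx i2 mul1r big1 ?addr0 // => k ki.
    rewrite mxE; case: eqP => [ik|]; last by rewrite mul0r.
    by case/eqP: ki; apply: val_inj; rewrite /= inordK.
  by rewrite big1 // => k _; rewrite mxE i2 andbF mul0r.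
apply/matrixP => i j; rewrite mxE -[X in _ *m X]trmxK tr_pid_mx mxE.
under eq_bigr do rewrite mxE mulrC mxE.
rewrite pidL andbC; case: (j < 2)%N => //=.
by rewrite pidL.
Qed.

Lemma frakWP (A : 'M[R]_(m, n)) : A \in frakW R n m ->
  exists a b, A = a *: corner_mx n m 1%:M + b *: corner_mx n m (J2 R).
Proof.
rewrite /frakW span_cons span_seq1.
move=> /memv_addP[_ /vlineP[a ->] [_ /vlineP[b ->] ->]].
by exists a, b.
Qed.

Lemma mem_frakW B : B = 1%:M \/ B = J2 R -> corner_mx n m B \in frakW R n m.
Proof.
by move=> HB; apply: memv_span; rewrite !inE; case: HB => ->; rewrite eqxx ?orbT.
Qed.

Lemma row_mx_J2_col p q (a b : 'cV[R]_p) (c d : 'rV[R]_q) :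
  (row_mx a b : 'M_(p, 2)) *m J2 R *m (col_mx c d : 'M_(2, q)) = b *m c - a *m d.
Proof.
have -> : row_mx a b *m J2 R = row_mx b (- a).
  apply: etrans (mul_row_block a b 0 (- 1%:M) 1%:M 0) _.
  by rewrite !mulmx0 add0r addr0 mulmxN !mulmx1.
by apply: etrans (mul_row_col b (- a) c d) _; rewrite mulNmx.
Qed.

Lemma row_mx_1_col p q (a b : 'cV[R]_p) (c d : 'rV[R]_q) :
  (row_mx a b : 'M_(p, 2)) *m 1%:M *m (col_mx c d : 'M_(2, q)) = a *m c + b *m d.
Proof. by rewrite mulmx1; apply: etrans (mul_row_col a b c d) _. Qed.

Definition characteristic (x : 'cV[C]_m) (u : 'rV[C]_n) : Prop :=
  [/\ x != 0, u != 0 & in_complexification V (x *m u)].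

(** If neither [x] nor [u] is proportional to a real vector, take [P] with first
columns Re x, Im x and [Q] with first rows Im u, Re u.  Then the two generators
of P W Q are Im (x u) and - Re (x u). *)
Lemma characteristic_rank_one_or_PWQ (x : 'cV[C]_m) (u : 'rV[C]_n) :
  characteristic x u ->
  (exists2 f, f \in V & rank_one f) \/ contains_PWQ V.
Proof.
move=> [x0 u0 xuV].
have [uRI|[z [e ue]]] := real_direction u0; last first.
  left; have e0 : e != 0.
    by apply: contraNneq u0 => e0; rewrite ue e0 cmx00 scaler0.
  have z0 : z != 0 by apply: contraNneq u0 => z0; rewrite ue z0 scale0r.
  move: xuV; rewrite ue -scalemxAr scalemxAl -[z *: x]cmxE cmx_mul !mulmx0 subr0 add0r.
  rewrite /in_complexification ReM_cmx ImM_cmx => -[ReV ImV].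
  have [Re0|] := eqVneq (ReM (z *: x)) 0; last first.
    by move=> r0; exists (mxop (ReM (z *: x) *m e)) => //; apply: rank_one_mxop.
  exists (mxop (ImM (z *: x) *m e)) => //; apply: rank_one_mxop => //.
  apply: contraNneq x0 => Im0; have : z *: x == 0.
    by rewrite -[z *: x]cmxE Re0 Im0 cmx00.
  by rewrite scaler_eq0 (negbTE z0).
have xT0 : x^T != 0 by rewrite trmx_eq0.
have [xRI|[z [e xe]]] := real_direction xT0; last first.
  left; have e0 : e^T != 0.
    by apply: contraNneq xT0 => e0; rewrite xe -[e]trmxK e0 trmx0 cmx00 scaler0.
  have z0 : z != 0 by apply: contraNneq xT0 => z0; rewrite xe z0 scale0r.
  have {}xe : x = z *: cmx e^T 0.
    by rewrite -[x]trmxK xe; apply/matrixP => i j; rewrite !mxE.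
  move: xuV; rewrite xe -scalemxAl scalemxAr -[z *: u]cmxE cmx_mul !mul0mx subr0 addr0.
  rewrite /in_complexification ReM_cmx ImM_cmx => -[ReV ImV].
  have [Re0|] := eqVneq (ReM (z *: u)) 0; last first.
    by move=> r0; exists (mxop (e^T *m ReM (z *: u))) => //; apply: rank_one_mxop.
  exists (mxop (e^T *m ImM (z *: u))) => //; apply: rank_one_mxop => //.
  apply: contraNneq u0 => Im0; have : z *: u == 0.
    by rewrite -[z *: u]cmxE Re0 Im0 cmx00.
  by rewrite scaler_eq0 (negbTE z0).
right.
have [m2 [Pt uPt PtE]] := row_free_pid_mul xRI.
have uIR : row_free (col_mx (ImM u) (ReM u)).
  by rewrite /row_free -addsmxE addsmxC addsmxE.
have [n2 [Q uQ QE]] := row_free_pid_mul uIR.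
split=> //; exists Pt^T, Q; split=> // [|A /frakWP[a [b ->]]].
  by rewrite unitmx_tr.
have PE : Pt^T *m pid_mx 2 = row_mx (ReM x) (ImM x).
  by rewrite -[pid_mx 2]trmxK tr_pid_mx -trmx_mul PtE tr_col_mx -!map_trmx !trmxK.
rewrite mulmxDr mulmxDl -!scalemxAr -!scalemxAl !corner_mxE.
rewrite !mulmxA PE -!mulmxA QE !mulmxA row_mx_J2_col row_mx_1_col.
move: xuV; rewrite -{1}[x]cmxE -{1}[u]cmxE cmx_mul.
rewrite /in_complexification ReM_cmx ImM_cmx => -[ReV ImV].
have -> : b *: (ImM x *m ImM u - ReM x *m ReM u) =
          (- b) *: (ReM x *m ReM u - ImM x *m ImM u).
  by rewrite scaleNr -scalerN opprB.
exact: mxop_lin_mem.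
Qed.

Lemma rank_one_characteristic f :
  f \in V -> rank_one f -> exists x u, characteristic x u.
Proof.
move=> fV /rank_one_outer_product[a [b [a0 b0 fE]]]; exists (cmx a 0), (cmx b 0); split.
- exact: cmx_neq0.
- exact: cmx_neq0.
- rewrite cmx_mul !mulmx0 mul0mx subr0 addr0 /in_complexification ReM_cmx ImM_cmx -fE.
  by rewrite mxop0 mem0v.
Qed.

(** The matrix I + i J has rank one: it is the column (1, i) times the row
(1, - i).  Multiplying by [P] and [Q] gives the characteristic. *)
Lemma contains_PWQ_characteristic :
  contains_PWQ V -> exists x u, characteristic x u.
Proof.
move=> [n2 m2 [P [Q [uP uQ PWQ]]]].
pose P2 : 'M_(m, 1 + 1) := P *m pid_mx 2; pose Q2 : 'M_(1 + 1, n) := pid_mx 2 *m Q.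
have inV B : B = 1%:M \/ B = J2 R -> mxop (P2 *m B *m Q2) \in V.
  by move=> /mem_frakW/PWQ; rewrite corner_mxE !mulmxA.
exists (cmx (lsubmx P2) (rsubmx P2)), (cmx (usubmx Q2) (- dsubmx Q2)).
split.
- apply/cmx_neq0/eqP => P20.
  have : lsubmx (pid_mx 2 : 'M[R]_(m, 1 + 1)) = 0.
    have -> : pid_mx 2 = invmx P *m P2 :> 'M[R]_(m, 1 + 1) by rewrite mulKmx.
    by rewrite -mulmx_lsub P20 mulmx0.
  move=> /matrixP/(_ (Ordinal (ltnW m2)) 0); rewrite !mxE /=.
  by move/eqP; rewrite oner_eq0.
- apply/cmx_neq0/eqP => Q20.
  have : usubmx (pid_mx 2 : 'M[R]_(1 + 1, n)) = 0.
    have -> : pid_mx 2 = Q2 *m invmx Q :> 'M[R]_(1 + 1, n) by rewrite mulmxK.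
    by rewrite -mul_usub_mx Q20 mul0mx.
  move=> /matrixP/(_ 0 (Ordinal (ltnW n2))); rewrite !mxE /=.
  by move/eqP; rewrite oner_eq0.
- have := inV _ (or_introl erefl); have := inV _ (or_intror erefl).
  rewrite -[P2]hsubmxK -[Q2]vsubmxK row_mx_J2_col row_mx_1_col.
  rewrite row_mxKl row_mxKr col_mxKu col_mxKd.
  rewrite cmx_mul !mulmxN opprK /in_complexification ReM_cmx ImM_cmx addrC.
  by split.
Qed.
End Characteristics.

(** * Real symmetric multilinear maps *)

Section RealMaps.
Variables (R : realType) (n m : nat).
Local Notation C := R[i].
Local Notation ReM := (map_mx (@complex.Re R)).
Variable V : {vspace 'Hom('cV[R]_n, 'cV[R]_m)}.

Lemma M_cst0 k : M V (cst 0 : k.-tuple 'cV[R]_n -> 'cV[R]_m).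
Proof.
case: k => // k; split; first by split=> // x i a u v; rewrite scaler0 addr0.
by move=> x; exists 0; rewrite ?mem0v // => v; rewrite lfunE.
Qed.

Lemma M_neq0P k : M V (k := k) <> [set cst 0]%classic <->
  exists2 T : k.-tuple 'cV[R]_n -> 'cV[R]_m, M V T & exists x, T x != 0.
Proof.
split=> [MN|[T MT [x Tx]] M0]; last by move: MT Tx; rewrite M0 => -> /eqP.
apply: contrapT => noT; apply: MN; apply/seteqP.
split=> T /=; last by move->; exact: M_cst0.
move=> MT; apply/funext => x; apply: contrapT => Tx; apply: noT; exists T => //.
by exists x; apply/eqP.
Qed.

Section PowerMap.
Variables (x : 'cV[C]_m) (u : 'rV[C]_n).

Definition pairing (v : 'cV[R]_n) : C := (u *m cmx v 0) 0 0.

(** The real part of the symmetric tensor z u^k x.  The factor [z] serves to make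
a coordinate of a chosen nonzero value of u^k x real. *)
Definition power_map (z : C) k (v : k.-tuple 'cV[R]_n) : 'cV[R]_m :=
  ReM ((z * \prod_(w <- v) pairing w) *: x).

Lemma pairing_linear a v w : pairing (a *: v + w) = a%:C%C * pairing v + pairing w.
Proof.
rewrite /pairing; have -> : cmx (a *: v + w) 0 = a%:C%C *: cmx v 0 + cmx w 0.
  by rewrite cmx_lin /= !scale0r !scaler0 subr0 !addr0.
by rewrite mulmxDr -scalemxAr !mxE.
Qed.

Lemma ReM_lin (a : R) p q (A B : 'M[C]_(p, q)) :
  ReM (a%:C%C *: A + B) = a *: ReM A + ReM B.
Proof.
apply/matrixP => i j; rewrite !mxE.
by case: (A i j) => ? ?; case: (B i j) => ? ?; rewrite /= mul0r subr0.
Qed.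

Lemma power_map_Sym z k : Defs.Sym (@power_map z k).
Proof.
split=> [v i a w1 w2|s v]; rewrite /power_map.
  rewrite !big_tuple -ReM_lin; congr (ReM _).
  have split_i w : \prod_(j < k) pairing (tnth (subst_tuple v i w) j) =
      pairing w * \prod_(j < k | j != i) pairing (tnth v j).
    rewrite (bigD1 i) //= tnth_mktuple eqxx; congr (_ * _).
    by apply: eq_bigr => j ji; rewrite tnth_mktuple (negbTE ji).
  rewrite !split_i pairing_linear scalerA -scalerDl; congr (_ *: _).
  by ring.
congr (map_mx _ ((_ * _) *: _)); apply: perm_big; apply/tuple_permP.
by exists s.
Qed.

Lemma power_map_M z k : in_complexification V (x *m u) ->
  M V (@power_map z k).
Proof.
case: k => // k xuV; split; first exact: power_map_Sym.
move=> v; set c := z * \prod_(w <- v) pairing w.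
have [cV _] := linear_predZ (in_complexification_linear V) c xuV.
exists (mxop (ReM (c *: (x *m u)))) => // w.
rewrite mxopE /power_map (perm_big (w :: v)) /=; last by rewrite perm_rcons.
rewrite big_cons; set A := c *: (x *m u).
have -> : ReM A *m w = ReM (A *m cmx w 0).
  by rewrite -{2}[A]cmxE cmx_mul !mulmx0 subr0 ReM_cmx.
congr (map_mx _ _); rewrite /A -scalemxAl -mulmxA [u *m _]mx11_scalar mul_mx_scalar.
by rewrite scalerA /c -mulrA [_ * pairing w]mulrC.
Qed.

End PowerMap.

Lemma characteristic_M_neq0 x u k : characteristic V x u ->
  M V (k := k) <> [set cst 0]%classic.
Proof.
move=> [x0 u0 xuV]; apply/M_neq0P.
have /cV0Pn[l xl] := x0.
have /rV0Pn[j uj] := u0.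
exists (@power_map x u (u 0 j ^+ k * x l 0)^-1 k); first exact: power_map_M.
exists [tuple of nseq k (delta_mx j 0)].
apply/eqP => /colP/(_ l); rewrite !mxE big_tuple.
under eq_bigr do rewrite tnth_nseq.
rewrite prodr_const card_ord.
have -> : pairing u (delta_mx j 0) = u 0 j.
  rewrite /pairing (_ : cmx _ 0 = delta_mx j 0) -?colE ?mxE //.
  by apply/matrixP => p q; rewrite !mxE; case: (_ && _).
rewrite -mulrA mulVf ?mulf_neq0 ?expf_neq0 //=.
by move/eqP; rewrite oner_eq0.
Qed.

Lemma multilinear_sum_delta k (T : k.-tuple 'cV[R]_n -> 'cV[R]_m) x i :
  multilinear T ->
  T x = \sum_l tnth x i l 0 *: T (subst_tuple x i (delta_mx l 0)).
Proof.
move=> linT.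
pose f : {linear 'cV[R]_n -> 'cV[R]_m} :=
  HB.pack (fun v => T (subst_tuple x i v)) (GRing.isLinear.Build _ _ _ _ _ (linT x i)).
have {1}-> : x = subst_tuple x i (tnth x i).
  by apply: eq_from_tnth => j; rewrite tnth_mktuple; case: eqP => [->|].
have -> : T (subst_tuple x i (tnth x i)) = f (tnth x i) by [].
rewrite {1}[tnth x i]matrix_sum_delta linear_sum; apply: eq_bigr => l _.
by rewrite big_ord_recl big_ord0 addr0 linearZ.
Qed.

(** The arguments are expanded in the basis one after the other, from the last
place to the first: [main j] leaves the arguments at the first [j] places free
and takes the others in the basis. *)
Lemma multilinear_eq0 k (T : k.-tuple 'cV[R]_n -> 'cV[R]_m) :
  multilinear T ->
  (forall t : k.-tuple 'I_n, T [tuple of map (fun j => delta_mx j 0) t] = 0) ->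
  forall x, T x = 0.
Proof.
move=> linT T0.
suff main j x :
    (forall i : 'I_k, (j <= i)%N -> exists l, tnth x i = delta_mx l 0) -> T x = 0.
  by move=> x; apply: (main k) => i; rewrite leqNgt ltn_ord.
elim: j x => [|j IH] x xE.
  have [t tE] := choice (fun i => xE i isT).
  rewrite -(T0 [tuple t i | i < k]); congr T; apply: eq_from_tnth => i.
  by rewrite tnth_map tnth_mktuple.
have [lejk|ltkj] := leqP k j.
  by apply: IH => i lji; have := ltn_ord i; rewrite ltnNge (leq_trans lejk).
rewrite (multilinear_sum_delta x (Ordinal ltkj) linT) big1 // => l _.
rewrite IH ?scaler0 // => i ji; rewrite tnth_mktuple; case: eqP => [_|/eqP ij].
  by exists l.
by apply: xE; rewrite ltn_neqAle ji andbT eq_sym.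
Qed.

Definition coordinates k (T : k.-tuple 'cV[R]_n -> 'cV[R]_m) : tensor R[i] n m k :=
  [ffun t : k.-tuple 'I_n => cmx (T [tuple of map (fun j => delta_mx j 0) t]) 0].

Lemma prolong_coordinates k (T : k.+1.-tuple 'cV[R]_n -> 'cV[R]_m) :
  M V T -> prolong (in_complexification V) 0 (coordinates T).
Proof.
move=> [[linT symT] VT].
have symC (t t' : k.+1.-tuple 'I_n) :
    perm_eq t t' -> coordinates T t = coordinates T t'.
  move=> /tuple_permP[s ts]; rewrite !ffunE; congr (cmx _ _).
  rewrite -[RHS](symT s); congr T; apply: val_inj; rewrite /= ts -!map_comp.
  by apply: eq_map => i /=; rewrite tnth_map.
split=> // [t|u]; last first.
  rewrite submx0 => /eqP->; apply/ffunP => t; rewrite !ffunE.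
  by rewrite big1 // => i _; rewrite mxE scale0r.
have [f fV fE] := VT [tuple of map (fun j => delta_mx j 0) t].
have -> : slice (coordinates T) t = cmx (\matrix_(l, j) f (delta_mx j 0) l 0) 0.
  apply/matrixP => l j; rewrite !mxE.
  rewrite (symC _ [tuple of rcons t j]); last by rewrite /= perm_sym perm_rcons.
  rewrite ffunE !mxE fE; congr (T _ _ _ +i* _)%C.
  by apply: val_inj; rewrite /= map_rcons.
rewrite /in_complexification ReM_cmx ImM_cmx.
have -> : mxop (\matrix_(l, j) f (delta_mx j 0) l 0) = f.
  apply/lfunP => v; rewrite mxopE {2}[v]matrix_sum_delta linear_sum.
  apply/colP => l; rewrite summxE mxE; apply: eq_bigr => j _.
  by rewrite big_ord_recl big_ord0 addr0 linearZ !mxE mulrC.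
by rewrite mxop0 mem0v.
Qed.

Lemma coordinates_neq0 k (T : k.-tuple 'cV[R]_n -> 'cV[R]_m) x :
  multilinear T -> T x != 0 -> coordinates T != 0.
Proof.
move=> linT; apply: contraNneq => T0; apply/eqP; apply: multilinear_eq0 => // t.
apply/eqP; apply: contraTT (eqxx (0 : 'cV[R[i]]_m)) => /cmx_neq0-/(_ 0).
by move/ffunP/(_ t): T0; rewrite !ffunE => ->.
Qed.

End RealMaps.

Theorem theorem2 (R : realType) (n m : nat) (hn : (1 <= n)%N) (hm : (1 <= m)%N)
    (V : {vspace 'Hom('cV[R]_n, 'cV[R]_m)}) :
  (delta V < +oo)%E <->
  ~ (exists2 f : 'Hom('cV[R]_n, 'cV[R]_m), f \in V & rank_one f) /\
  ~ contains_PWQ V.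
Proof.
split=> [fin|[norank noPWQ]].
  suff noch : ~ exists x u, characteristic V x u.
    split=> [[f fV f1]|PWQ]; apply: noch.
      exact: rank_one_characteristic fV f1.
    exact: contains_PWQ_characteristic.
  move=> [x [u xu]].
  have ge k : (k%:R%:E <= delta V)%E.
    by apply: ereal_sup_ubound; exists k => //; apply: characteristic_M_neq0 xu.
  case: (delta V) fin ge => [r| |] // _ ge; last by have := ge 0%N.
  have := ge (Num.bound `|r|); rewrite lee_fin leNgt => /negP; apply.
  exact: le_lt_trans (ler_norm r) (archi_boundP (normr_ge0 r)).
have [live|/(finite_type_vanish (in_complexification_linear V))[k0 dead]] :=
  pselect (infinite_type (in_complexification V) 0).
  have [A AV rA] := infinite_type_rank_one (in_complexification_linear V) live.
  have [x [u [x0 u0 xuA]]] := rank1_factor rA.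
  have : characteristic V x u by split=> //; rewrite -xuA.
  by move=> /characteristic_rank_one_or_PWQ[].
suff le0 : (delta V <= (k0%:R : R)%:E)%E by exact: le_lt_trans le0 (ltry _).
apply: ge_ereal_sup => _ [k /= /M_neq0P[T MT [x Tx]] <-].
rewrite lee_fin ler_nat leqNgt; apply/negP; case: k T MT x Tx => // k T MT x Tx ltk.
have := coordinates_neq0 (proj1 (proj1 MT)) Tx.
by rewrite (dead k ltk _ (prolong_coordinates MT)) eqxx.
Qed.
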